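(* The map $\Phi$ is an isomorphism of symmetric set-operads from $\mathrm{RW}$ onto the symmetric sub-set-operad of $\mathcal{FF}^\Sigma$ generated by $F_\succ=\frac{1}{[1][12]}$, $F_\mu=\frac{1}{[12]}$ and $F_\odot=\frac{1}{[1][2]}$.
   Context: Red and white trees: $\mathrm{RW}(n)$ is the set of finite rooted trees (children unordered) whose nodes $z$ carry possibly empty label sets $L(z)\subseteq[n]$ partitioning $[n]$, each empty node having at least two children; labelled nodes are white, an empty node is red iff all its children are white. $S_n$ acts by relabelling. Composition $T_1\circ_xT_2$ ($T_1\in\mathrm{RW}(m)$, $T_2\in\mathrm{RW}(n)$): relabel $T_1$ by $y\mapsto y+n-1$ for $y>x$ and $T_2$ by $y\mapsto y+x-1$; $z\ni x$ in $T_1$, $r$ = root of $T_2$. (W) $r$ not red: remove $x$ from $L(z)$, add $L(r)$ to $L(z)$, children of $r$ become children of $z$. (R1) $r$ red, $T_1$ the single node $\{x\}$: result $T_2$. (R2) $r$ red and ($z$ has a child or $|L(z)|\ge2$): remove $x$ from $L(z)$, attach $T_2$ as child subtree of $z$. (R3) $r$ red, $z$ non-root leaf with $L(z)=\{x\}$: delete $z$, children of $r$ become children of the parent of $z$. Colours recomputed. This is a symmetric set-operad. Formal fractions: $\mathcal{FF}(n)$ is the set of reduced formal fractions whose numerator and denominator are products of symbols $[S]$, $\emptyset\ne S\subseteq[n]$; $F\circ_iG=[S_{i,n}]\,F(1,\dots,i-1,S_{i,n},i+n,\dots,m+n-1)\,G(i,\dots,i+n-1)$ with $S_{i,n}=\{i,\dots,i+n-1\}$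 and $F(A_1,\dots,A_m)$ replacing each $[S]$ by $[\bigcup_{k\in S}A_k]$; $\mathcal{FF}^\Sigma$ is this operad with $\sigma\in S_n$ acting by $[S]\mapsto[\sigma(S)]$. $\Phi(T)=\prod_zE(z)$ over nodes $z$ of $T$, where $S(z)$ is the set of labels in the subtree rooted at $z$ and $E(z)=1/[S(z)]$ if $z$ is white, $[S(z)]$ if $z$ is red and not the root, $1$ if $z$ is the red root. *)

(* Defs.v *)
From HB Require Import structures.
From mathcomp Require Import all_boot all_order all_algebra all_fingroup.
From Stdlib Require Sorting.Permutation Lists.List.
Set Implicit Arguments. Unset Strict Implicit. Unset Printing Implicit Defensive.
Import GRing.Theory.
Local Open Scope ring_scope.

(* Red and white trees.  Labels are natural numbers; a tree of arity n
   uses the labels 0..n-1 (label k stands for the paper's label k+1).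
   Children are stored in a list; unorderedness is handled by the
   equivalence [rw_equiv] below (permuting children and the elements of
   a label list).                                                      *)
Inductive rwtree : Type := RWNode of seq nat & seq rwtree.

Definition rw_lab (t : rwtree) : seq nat := let: RWNode L _ := t in L.
Definition rw_children (t : rwtree) : seq rwtree := let: RWNode _ cs := t in cs.

Fixpoint labels (t : rwtree) : seq nat :=
  let: RWNode L cs := t in L ++ flatten (map labels cs).

Fixpoint rw_wf (t : rwtree) : bool :=
  let: RWNode L cs := t in ((L != [::]) || (1 < size cs)%N) && all rw_wf cs.

Definition is_rw (n : nat) (t : rwtree) : bool :=
  perm_eq (labels t) (iota 0 n) && rw_wf t.

Inductive rw_equiv : rwtree -> rwtree -> Prop :=
| RWEquiv L L' cs cs' cs'' :
    perm_eq L L' -> Permutation.Permutation cs' cs'' ->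
    List.Forall2 rw_equiv cs cs'' -> rw_equiv (RWNode L cs) (RWNode L' cs').

Fixpoint red (t : rwtree) : bool :=
  let: RWNode L cs := t in (L == [::]) && all (fun c => ~~ red c) cs.

Fixpoint relab (f : nat -> nat) (t : rwtree) : rwtree :=
  let: RWNode L cs := t in RWNode (map f L) (map (relab f) cs).

Definition act_rw (n : nat) (s : 'S_n) (t : rwtree) : rwtree :=
  relab (fun y => if (insub y : option 'I_n) is Some i then val (s i) else y) t.

Fixpoint graft (x : nat) (r : rwtree) (t : rwtree) : seq rwtree :=
  let: RWNode L cs := t in
  if x \in L then
    let: RWNode Lr csr := r in
    if ~~ red r then [:: RWNode (rem x L ++ Lr) (cs ++ csr)]
    else if ~~ nilp cs || (1 < size L)%N then [:: RWNode (rem x L) (rcons cs r)]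
    else csr
  else [:: RWNode L (flatten (map (graft x r) cs))].

Definition is_single (x : nat) (t : rwtree) : bool :=
  match t with RWNode [:: y] [::] => y == x | _ => false end.

(* partial composition T1 o_x T2 with T2 in RW(n.+1), x the (0-based) label *)
Definition rw_comp (n x : nat) (t1 t2 : rwtree) : rwtree :=
  let t1' := relab (fun y => if (x < y)%N then (y + n)%N else y) t1 in
  let r := relab (fun y => (y + x)%N) t2 in
  if red r && is_single x t1' then r
  else head t1' (graft x r t1').

Definition rw_unit : rwtree := RWNode [:: 0%N] [::].

(* Formal fractions: a reduced formal fraction in the symbols [S],
   S a nonempty subset of [n], is encoded by its exponent vector
   (numerator exponents positive, denominator exponents negative).    *)
Definition nesym (n : nat) := {S : {set 'I_n} | S != set0}.
Definition FF (n : nat) := {ffun nesym n -> int}.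

Definition sym (n : nat) (S : {set 'I_n}) : FF n :=
  [ffun T : nesym n => if val T == S then 1 else 0].

Definition act_ff (n : nat) (s : 'S_n) (F : FF n) : FF n :=
  [ffun T : nesym n => \sum_(S : nesym n | s @: val S == val T) F S].

Definition ins_rel (m n : nat) (i : 'I_m.+1) (k : 'I_m.+1) (j : 'I_(m + n).+1) : bool :=
  if (k < i)%N then val j == val k
  else if val k == val i then (i <= j <= i + n)%N
  else val j == (val k + n)%N.

Definition ff_comp (m n : nat) (i : 'I_m.+1) (F : FF m.+1) (G : FF n.+1) : FF (m + n).+1 :=
  [ffun T : nesym (m + n).+1 =>
     (if val T == [set j : 'I_(m + n).+1 | (i <= j <= i + n)%N] then 1 else 0)
     + \sum_(S : nesym m.+1 |
             [set j | [exists k in val S, @ins_rel m n i k j]] == val T) F S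
     + \sum_(S : nesym n.+1 |
             [set j : 'I_(m + n).+1 | [exists k in val S, val j == (val k + i)%N]] == val T) G S].

Definition ff_unit : FF 1 := - sym [set ord0].
Definition F_succ : FF 2 := - (sym [set ord0] + sym setT).
Definition F_mu : FF 2 := - sym setT.
Definition F_odot : FF 2 := - (sym [set ord0] + sym [set ord_max]).

Inductive gen : forall n, FF n -> Prop :=
| gen_unit : gen ff_unit
| gen_succ : gen F_succ
| gen_mu : gen F_mu
| gen_odot : gen F_odot
| gen_comp (m n : nat) (i : 'I_m.+1) (F : FF m.+1) (G : FF n.+1) : gen F -> gen G -> gen (ff_comp i F G)
| gen_act (n : nat) (s : 'S_n) (F : FF n) : gen F -> gen (act_ff s F).

Definition labset (n : nat) (s : seq nat) : {set 'I_n} := [set i : 'I_n | val i \in s].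

Fixpoint contrib (n : nat) (root : bool) (t : rwtree) (T : {set 'I_n}) : int :=
  let: RWNode L cs := t in
  (if labset n (labels t) == T then
     (if red t then (if root then 0 else 1) else -1) else 0)
  + \sum_(v <- map (fun c => contrib false c T) cs) v.

Definition Phi (n : nat) (t : rwtree) : FF n :=
  [ffun T : nesym n => contrib true t (val T)].

(* Main.v *)
(* Every node set S(z) of a red and white tree determines z, because an empty node
   has at least two children with disjoint nonempty label sets.  Hence no
   cancellation occurs in Phi(T), apart from a red root the exponents are +1 or -1,
   and T is recovered from the laminar family of its node sets.

   Replacing the symbol [S] by an arbitrary weight w(S) turns Phi into a sum over
   nodes, and compatibility with composition becomes one identity for such sums
   (wsum_graft): the root of the grafted tree r and the node z containing x account
   for w(S(r)) in each of the cases (W), (R1), (R2), (R3).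

   For surjectivity, a tree is built by adding one child or one label at a time:
   grafting into the two free labels a, b of the trees of F_succ, F_mu, F_odot adds a
   label to a non-red root, adds a child to a non-red root, or puts two trees with
   non-red roots below a red root (merging a red root with the new one). *)
Require Import Defs.
From HB Require Import structures.
From mathcomp Require Import all_boot all_order all_algebra all_fingroup.
From mathcomp Require Import zify.
From Stdlib Require Permutation List.
Set Implicit Arguments. Unset Strict Implicit. Unset Printing Implicit Defensive.
Import GRing.Theory.
Local Open Scope ring_scope.

(** * Weighted node sums *)

(** The embedding into [GenTree.tree] gives [rwtree] a decidable equality, so that lists of children
    can be handled with [\in] and [perm_eq]. The label list becomes the first leaf. *)
Fixpoint rw_encode (t : rwtree) : GenTree.tree (seq nat) :=
  let: RWNode L cs := t in GenTree.Node 0 (GenTree.Leaf L :: map rw_encode cs).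

Fixpoint rw_decode (g : GenTree.tree (seq nat)) : rwtree :=
  match g with
  | GenTree.Node _ (GenTree.Leaf L :: gs) => RWNode L (map rw_decode gs)
  | _ => RWNode [::] [::]
  end.

Lemma rw_encodeK : cancel rw_encode rw_decode.
Proof.
rewrite /cancel; fix IH 1 => -[L cs] /=; congr RWNode.
elim: cs => //= c cs IHcs; congr (_ :: _) => //; exact: IH.
Qed.

HB.instance Definition _ := Equality.copy rwtree (can_type rw_encodeK).

(** Since [rwtree] is nested through [seq], the hypothesis on the children is phrased by membership,
    which suits maps and sums over [cs]. *)
Lemma rwtree_in_ind (P : rwtree -> Prop) :
  (forall L cs, (forall c, c \in cs -> P c) -> P (RWNode L cs)) -> forall t, P t.
Proof.
move=> H; fix IH 1 => -[L cs]; apply: H.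
elim: cs => [|c cs IHcs] d; rewrite (in_nil, in_cons); first by case/notF.
by case/orP => [/eqP->|]; [exact: IH c|exact: IHcs].
Qed.

Lemma perm_eq_Permutation (T : eqType) (s1 s2 : seq T) :
  perm_eq s1 s2 -> Permutation.Permutation s1 s2.
Proof.
elim: s1 s2 => [|x s1 IH] s2 e12.
  by move: e12; rewrite perm_sym => /perm_nilP->.
have x2: x \in s2 by rewrite -(perm_mem e12) mem_head.
case/splitPr: x2 e12 => a b; rewrite perm_sym perm_catC /= perm_cons perm_catC perm_sym => /IH e.
exact: Permutation.Permutation_cons_app.
Qed.

Lemma Permutation_perm_eq (T : eqType) (s1 s2 : seq T) :
  Permutation.Permutation s1 s2 -> perm_eq s1 s2.
Proof.
elim=> {s1 s2} [|x s1 s2 _|x y s|s1 s2 s3 _ e12 _] //=.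
- by rewrite perm_cons.
- by rewrite -[[:: y, x & s]]/([:: y] ++ [:: x] ++ s) perm_catCA.
- exact: perm_trans.
Qed.

Lemma labelsE L cs : labels (RWNode L cs) = L ++ flatten (map labels cs).
Proof. by []. Qed.

Lemma redE L cs : red (RWNode L cs) = (L == [::]) && all (fun c => ~~ red c) cs.
Proof. by []. Qed.

Lemma rw_wfE L cs :
  rw_wf (RWNode L cs) = ((L != [::]) || (1 < size cs)%N) && all rw_wf cs.
Proof. by []. Qed.

Lemma mem_labels_child c L cs : c \in cs -> {subset labels c <= labels (RWNode L cs)}.
Proof.
move=> ccs x xc; rewrite labelsE mem_cat; apply/orP; right.
by apply/flattenP; exists (labels c) => //; apply: map_f.
Qed.

(** Weights live on label lists rather than on subsets of a fixed [[n]]: one sum serves all arities,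
    and relabelling or grafting is absorbed by a change of weight. *)
Fixpoint wsum (w : seq nat -> int) (root : bool) (t : rwtree) : int :=
  let: RWNode L cs := t in
  (if red t then (if root then 0 else w (labels t)) else - w (labels t))
  + \sum_(v <- map (wsum w false) cs) v.

Lemma wsumE w root L cs : wsum w root (RWNode L cs) =
  (if red (RWNode L cs) then (if root then 0 else w (labels (RWNode L cs)))
   else - w (labels (RWNode L cs))) + \sum_(c <- cs) wsum w false c.
Proof. by rewrite /= big_map. Qed.

Lemma wsum_root w t :
  wsum w false t = wsum w true t + (if red t then w (labels t) else 0).
Proof.
case: t => L cs; rewrite !wsumE; case: ifP => _; last by rewrite addr0.
by rewrite add0r addrC.
Qed.

Definition set_ind n (T : {set 'I_n}) (l : seq nat) : int :=
  if labset n l == T then 1 else 0.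

Lemma contribE n root L cs (T : {set 'I_n}) : contrib root (RWNode L cs) T =
  (if labset n (labels (RWNode L cs)) == T then
     (if red (RWNode L cs) then (if root then 0 else 1) else -1) else 0)
  + \sum_(c <- cs) contrib false c T.
Proof. by rewrite /= big_map. Qed.

Lemma contrib_wsum n root t T : contrib root t T = wsum (@set_ind n T) root t.
Proof.
elim/rwtree_in_ind: t root => L cs IH root; rewrite wsumE.
rewrite [LHS]/=; congr (_ + _).
  by rewrite /set_ind; case: eqP; rewrite //= ?if_same ?oppr0 ?if_same.
by rewrite big_map; apply: eq_big_seq => c /IH.
Qed.

Lemma eq_in_wsum (P : pred nat) w w' root t : all P (labels t) ->
  (forall l, all P l -> w l = w' l) -> wsum w root t = wsum w' root t.
Proof.
move=> Pt eqw; elim/rwtree_in_ind: t root Pt => L cs IH root Pt.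
rewrite !wsumE eqw //; congr (_ + _); apply: eq_big_seq => c ccs.
apply: IH => //; apply/allP => x xc; apply: (allP Pt).
exact: mem_labels_child ccs _ xc.
Qed.

(** Grafting and [rw_equiv] reorder label lists, so the weights should depend on the underlying set
    alone. *)
Definition mem_ext (w : seq nat -> int) := forall l l', l =i l' -> w l = w l'.

Lemma labset_ext n l l' : l =i l' -> labset n l = labset n l'.
Proof. by move=> e; apply/setP => i; rewrite !inE e. Qed.

Lemma set_ind_ext n (T : {set 'I_n}) : mem_ext (set_ind T).
Proof. by move=> l l' e; rewrite /set_ind (labset_ext _ e). Qed.

(** * Invariance under reordering of labels and children *)

Lemma rw_equiv_inv L cs t' : rw_equiv (RWNode L cs) t' ->
  exists L' cs' cs'', [/\ t' = RWNode L' cs', perm_eq L L', perm_eq cs' cs''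
                        & List.Forall2 rw_equiv cs cs''].
Proof.
move=> e; inversion e as [L1 L' cs1 cs' cs'' eL eP eF]; exists L', cs', cs''.
by split=> //; apply: Permutation_perm_eq.
Qed.

Lemma rw_equiv_labels t t' : rw_equiv t t' -> perm_eq (labels t) (labels t').
Proof.
elim/rwtree_in_ind: t t' => L cs IH t' /rw_equiv_inv[L' [cs' [cs'' [-> eL eP eF]]]].
rewrite !labelsE; apply: perm_cat => //.
have/perm_trans: perm_eq (flatten (map labels cs)) (flatten (map labels cs'')).
  elim: eF IH => //= c c' ds ds' e _ IHd IH.
  apply: perm_cat; first by apply: IH; rewrite ?mem_head.
  by apply: IHd => d dds; apply: IH; rewrite inE dds orbT.
apply; apply/perm_flatten/perm_map; by rewrite perm_sym.
Qed.

Lemma rw_equiv_red t t' : rw_equiv t t' -> red t = red t'.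
Proof.
elim/rwtree_in_ind: t t' => L cs IH t' /rw_equiv_inv[L' [cs' [cs'' [-> eL eP eF]]]].
rewrite !redE; congr (_ && _).
  by rewrite -!size_eq0 (perm_size eL).
rewrite (perm_all _ eP).
elim: eF IH => //= c c' ds ds' e _ IHd IH.
rewrite (IH c _ c') ?mem_head // IHd // => d dds; apply: IH; by rewrite inE dds orbT.
Qed.

Lemma rw_equiv_wsum w root t t' : mem_ext w -> rw_equiv t t' ->
  wsum w root t = wsum w root t'.
Proof.
move=> we; elim/rwtree_in_ind: t root t' => L cs IH root t' e.
have := perm_mem (rw_equiv_labels e); have := rw_equiv_red e.
case/rw_equiv_inv: e => L' [cs' [cs'' [-> eL eP eF]]] eR eM.
rewrite !wsumE eR (we _ _ eM); congr (_ + _).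
rewrite (perm_big _ eP) {eL eP eR eM}.
elim: eF IH => // c c' ds ds' e _ IHd IH.
rewrite !big_cons (IH c _ false c') ?mem_head // IHd // => d dds.
by apply: IH; rewrite inE dds orbT.
Qed.

(** * Relabelling of trees and of weights *)

Lemma labels_relab f t : labels (relab f t) = map f (labels t).
Proof.
elim/rwtree_in_ind: t => L cs IH; rewrite /= map_cat map_flatten -!map_comp.
by congr (_ ++ flatten _); apply/eq_in_map.
Qed.

Lemma red_relab f t : red (relab f t) = red t.
Proof.
elim/rwtree_in_ind: t => L cs IH /=; rewrite all_map; congr (_ && _).
  by case: L.
by apply: eq_in_all => c /IH /= ->.
Qed.

Lemma rw_wf_relab f t : rw_wf (relab f t) = rw_wf t.
Proof.
elim/rwtree_in_ind: t => L cs IH /=; rewrite size_map all_map; congr (_ && _).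
  by case: L.
by apply: eq_in_all => c /IH /= ->.
Qed.

Lemma eq_in_relab f g t : {in labels t, f =1 g} -> relab f t = relab g t.
Proof.
elim/rwtree_in_ind: t => L cs IH e /=; congr RWNode.
  by apply/eq_in_map => x xL; apply: e; rewrite labelsE mem_cat xL.
apply/eq_in_map => c ccs; apply: IH => // x xc; apply: e.
exact: mem_labels_child ccs _ xc.
Qed.

Lemma relab_comp f g t : relab f (relab g t) = relab (f \o g) t.
Proof.
elim/rwtree_in_ind: t => L cs IH /=; congr RWNode; rewrite -map_comp //.
by apply/eq_in_map => c /IH.
Qed.

Lemma relab_id f t : {in labels t, f =1 id} -> relab f t = t.
Proof.
elim/rwtree_in_ind: t => L cs IH e /=; congr RWNode.
  by apply: map_id_in => x xL; apply: e; rewrite labelsE mem_cat xL.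
apply: map_id_in => c ccs; apply: IH => // x xc; apply: e.
exact: mem_labels_child ccs _ xc.
Qed.

Lemma wsum_relab w f root t :
  wsum w root (relab f t) = wsum (fun l => w (map f l)) root t.
Proof.
elim/rwtree_in_ind: t root => L cs IH root.
have := red_relab f (RWNode L cs); have := labels_relab f (RWNode L cs).
rewrite [relab _ _]/= => el er; rewrite !wsumE er el big_map; congr (_ + _).
by apply: eq_big_seq => c /IH.
Qed.

Lemma wf_labels_neq0 t : rw_wf t -> labels t != [::].
Proof.
elim/rwtree_in_ind: t => L [|c cs] IH; rewrite rw_wfE labelsE.
  by rewrite /= andbT orbF cats0.
case/andP=> _ /andP[wc _]; have := IH c (mem_head c cs) wc; rewrite [map _ _]/=.
by case: (labels c) => // x l _; case: L {IH}.
Qed.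

Lemma labset_neq0 n t : rw_wf t -> all (ltn^~ n) (labels t) ->
  labset n (labels t) != set0.
Proof.
move=> /wf_labels_neq0; case: (labels t) => // x l _ /= /andP[xn _].
by apply/set0Pn; exists (Ordinal xn); rewrite inE mem_head.
Qed.

Lemma all_child P c L cs : all P (labels (RWNode L cs)) -> c \in cs -> all P (labels c).
Proof. by move=> /allP H ccs; apply/allP => x /(mem_labels_child L ccs)/H. Qed.

(** The left side is the shape in which [act_ff] and [ff_comp] push exponents forward. Every node
    set of a well-formed tree is nonempty, hence is a symbol, so each node is counted exactly
    once. *)
Lemma sum_contrib n root t (P : pred {set 'I_n}) : rw_wf t -> all (ltn^~ n) (labels t) ->
  \sum_(S : Defs.nesym n | P (val S)) contrib root t (val S) =
  wsum (fun l => if P (labset n l) then 1 else 0) root t.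
Proof.
elim/rwtree_in_ind: t root => L cs IH root wft bt.
have ne := labset_neq0 wft bt.
rewrite wsumE; set w := fun l : seq nat => _; set t := RWNode L cs.
have -> : (if red t then if root then 0 else w (labels t) else - w (labels t)) =
   (if P (labset n (labels t)) then (if red t then (if root then 0 else 1) else -1) else 0).
  by rewrite /w; case: (P _); rewrite ?oppr0 ?if_same.
under eq_bigr do rewrite contribE.
rewrite big_split exchange_big; congr (_ + _); last first.
  apply: eq_big_seq => c ccs; apply: IH => //.
    by case/andP: wft => _ /allP; apply.
  exact: all_child bt ccs.
rewrite -big_mkcondr.
have [Pt|Pt] := boolP (P (labset n (labels t))).
  (* The symbol of the root is the only index at which its own term is nonzero. *)
  rewrite (big_pred1 (exist (fun S : {set 'I_n} => is_true (S != set0)) _ ne)) // => S.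
  rewrite [RHS]/= -[RHS]val_eqE [RHS]eq_sym.
  by case: eqP => [<-|]; rewrite ?Pt ?andbF.
rewrite big_pred0 // => S.
by case: eqP => [<-|]; rewrite ?(negbTE Pt) ?andbF.
Qed.

(** * Grafting *)

Lemma graft_in x Lr csr L cs (r := RWNode Lr csr) : x \in L ->
  graft x r (RWNode L cs) =
  if ~~ red r then [:: RWNode (rem x L ++ Lr) (cs ++ csr)]
  else if ~~ nilp cs || (1 < size L)%N then [:: RWNode (rem x L) (rcons cs r)]
  else csr.
Proof. by move=> xL; rewrite /= xL. Qed.

Lemma graft_below x r L cs : x \notin L ->
  graft x r (RWNode L cs) = [:: RWNode L (flatten (map (graft x r) cs))].
Proof. by move=> /negbTE xL; rewrite /= xL. Qed.

Lemma notin_child x c L cs : x \notin labels (RWNode L cs) -> c \in cs -> x \notin labels c.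
Proof. by move=> xt /(mem_labels_child L) sub; apply: contra xt => /sub. Qed.

Lemma graft_notin x r t : x \notin labels t -> graft x r t = [:: t].
Proof.
elim/rwtree_in_ind: t => L cs IH xt; rewrite graft_below; last first.
  by apply: contra xt => xL; rewrite labelsE mem_cat xL.
congr [:: RWNode _ _]; rewrite -[RHS]flatten_seq1; congr flatten.
by apply/eq_in_map => c ccs; apply: IH => //; apply: notin_child xt ccs.
Qed.

Lemma graft_child x r L a c b : x \notin L ->
  all (fun d => x \notin labels d) (a ++ b) ->
  graft x r (RWNode L (a ++ c :: b)) = [:: RWNode L (a ++ graft x r c ++ b)].
Proof.
move=> xL xab; rewrite graft_below //; congr [:: RWNode _ _].
have E s : all (fun d => x \notin labels d) s -> flatten (map (graft x r) s) = s.
  elim: s => //= d s IHs /andP[xd xs]; by rewrite graft_notin // IHs.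
by move: xab; rewrite all_cat => /andP[xa xb]; rewrite map_cat flatten_cat /= !E.
Qed.

Lemma uniq_labels_child c L cs : uniq (labels (RWNode L cs)) -> c \in cs -> uniq (labels c).
Proof.
rewrite labelsE cat_uniq => /and3P[_ _ uf] /(map_f labels).
elim: (map labels cs) uf => //= l ls IHl; rewrite cat_uniq => /and3P[ul _ uls].
by rewrite inE => /predU1P[->|/IHl->].
Qed.

(** Counting occurrences: [x] occurs at most once in total, and [c] already uses that occurrence. *)
Lemma uniq_labels_split x L a c b : uniq (labels (RWNode L (a ++ c :: b))) ->
  x \in labels c -> x \notin L /\ all (fun d => x \notin labels d) (a ++ b).
Proof.
move=> u xc; have {u} : (count_mem x (labels (RWNode L (a ++ c :: b))) <= 1)%N.
  by rewrite count_uniq_mem ?leq_b1.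
have {xc} : (0 < count_mem x (labels c))%N by rewrite -has_count has_pred1.
rewrite labelsE map_cat flatten_cat /= !count_cat => c1 c2.
have z s : count_mem x s = 0%N -> x \notin s by move=> e; rewrite -has_pred1 has_count e.
have z' s : count_mem x (flatten (map labels s)) = 0%N -> all (fun d => x \notin labels d) s.
  move=> /z xs; apply/allP => d ds; apply: contra xs => xd.
  by apply/flattenP; exists (labels d) => //; apply: map_f.
have zs (p q s d : nat) : (0 < s -> p + (q + (s + d)) <= 1 -> [/\ p = 0, q = 0 & d = 0])%N.
  by move=> *; split; lia.
by have [/z-> /z'-za /z'-zb] := zs _ _ _ _ c1 c2; rewrite all_cat za.
Qed.

(** Induction along the path from the root to the node containing [x]; uniqueness of labels leaves a
    single child to descend into. *)
Lemma graft_tree_ind x (P : rwtree -> Prop) :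
  (forall L cs, uniq (labels (RWNode L cs)) -> x \in L -> P (RWNode L cs)) ->
  (forall L a c b, uniq (labels (RWNode L (a ++ c :: b))) -> x \notin L ->
     all (fun d => x \notin labels d) (a ++ b) -> x \in labels c -> P c ->
     P (RWNode L (a ++ c :: b))) ->
  forall t, uniq (labels t) -> x \in labels t -> P t.
Proof.
move=> H1 H2; elim/rwtree_in_ind => L cs IH u; rewrite {1}labelsE mem_cat.
case: (boolP (x \in L)) => [xL _|xL /= /flattenP[l /mapP[c ccs ->] xc]]; first exact: H1.
have Pc : P c by apply: IH => //; apply: uniq_labels_child u ccs.
case/splitPr: ccs u {IH} => a b u; apply: H2 => //.
by case: (uniq_labels_split u xc).
Qed.

(** Keeping [x] on the left avoids removing it on the right, so the claim becomes a linear identity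
    between counts. The forest on the left covers (R3), where one node is replaced by several. *)
Lemma labels_graft x r t : uniq (labels t) -> x \in labels t ->
  perm_eq (x :: flatten (map labels (graft x r t))) (labels t ++ labels r).
Proof.
move: t; apply: graft_tree_ind => [L cs u xL|L a c b u xL xab xc IH].
  have [Lr [csr ->]] : exists Lr csr, r = RWNode Lr csr by case: r => Lr csr; exists Lr, csr.
  have /seq.permP eL := perm_to_rem xL.
  rewrite graft_in // [labels (RWNode L cs)]labelsE.
  case: ifP => [_|/negbFE]; [|rewrite redE => /andP[/eqP-> _]; case: ifP => [_|]].
  - rewrite [map _ _]/= [flatten _]/= cats0 map_cat flatten_cat labelsE.
    by apply/seq.permP => p; have := eL p; rewrite /= !count_cat; lia.
  - rewrite [map _ _]/= [flatten _]/= cats0 map_rcons flatten_rcons.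
    by apply/seq.permP => p; have := eL p; rewrite /= !count_cat; lia.
  - by case: cs L xL {u eL} => // [] [|y [|//]] //=; rewrite inE => /eqP->.
rewrite graft_child // [flatten _]/= cats0 !labelsE !map_cat !flatten_cat /=.
by apply/seq.permP => p; have /seq.permP/(_ p) := IH; rewrite /= !count_cat /=; lia.
Qed.

(** Colours above the graft do not change: the node containing [x] is white, and what replaces it is
    never red. In (R2) the new node has the red child [r]; in (R3) the children of a red node are
    not red. *)
Lemma nonred_graft x r t : uniq (labels t) -> x \in labels t ->
  all (fun u => ~~ red u) (graft x r t) = ~~ red t.
Proof.
move: t; apply: graft_tree_ind => [L cs u xL|L a c b u xL xab xc IH].
  have -> : red (RWNode L cs) = false by case: L xL {u}.
  case: r => Lr csr; rewrite graft_in //.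
  case: ifP => [nr|/negbFE rr]; last case: ifP => _.
  (* When [Lr] is empty, the non-red [r] has a red child, and this child survives in the merged
     node. *)
  - rewrite /= all_cat andbT; move: nr; rewrite redE; case: Lr => /= [|y Lr _]; last by case: (rem x L).
    by rewrite cats0 => /negbTE->; rewrite !andbF.
  - by rewrite /= all_rcons rr !andbF.
  - by move: rr; rewrite redE => /andP[].
by rewrite graft_child //= !all_cat /= IH andbT.
Qed.

(** Guarantees that replacing a child by its graft does not lower the number of children. *)
Lemma graft_neq0 x r t : rw_wf r -> (0 < size (graft x r t))%N.
Proof.
case: r => Lr csr; rewrite rw_wfE => /andP[nr _].
case: t => L cs; have [xL|xL] := boolP (x \in L); last by rewrite graft_below.
rewrite graft_in //; case: ifP => // /negbFE; rewrite redE => /andP[/eqP e _].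
by case: ifP => // _; move: nr; rewrite e /=; apply: ltnW.
Qed.

Lemma rw_wf_graft x r t : rw_wf r -> uniq (labels t) -> x \in labels t ->
  rw_wf t -> all rw_wf (graft x r t).
Proof.
move=> wr; move: t.
apply: graft_tree_ind => [L cs u xL|L a c b u xL xab xc IH]; rewrite rw_wfE => /andP[ne wcs].
  case: r wr => Lr csr wr; rewrite graft_in //.
  have:= wr; rewrite rw_wfE => /andP[nr wcsr].
  case: ifP => [_|/negbFE rr]; last case: ifP => // c.
  - rewrite [all _ _]/= andbT all_cat wcs wcsr !andbT size_cat.
    (* With [Lr] empty, [r] brings at least two children of its own. *)
    by case: Lr nr {wr} => [/= nr|y Lr _]; [apply/orP; right; lia|case: (rem x L)].
  - rewrite [all _ _]/= andbT all_rcons wr wcs !andbT size_rcons ltnS.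
    (* If [x] was the only label, then [cs] is nonempty, and together with [r] there are at least
       two children. *)
    by have := size_rem xL; case: (rem x L) => // e; move: c; case: cs {u ne wcs} => //=; case: L xL e => // y [].
rewrite graft_child // [all _ _]/= andbT; move: wcs ne; rewrite !all_cat /= => /and3P[-> wc ->].
rewrite IH // !andbT !size_cat /= => /orP[->//|lt1]; apply/orP; right.
by have := graft_neq0 x c wr; lia.
Qed.

(** List form of the substitution in a symbol [[S]]: the entry [x] is replaced by the block [s] of
    labels of the grafted tree. *)
Definition subst_labels x (s l : seq nat) :=
  if x \in l then filter (predC1 x) l ++ s else l.

Lemma subst_labels_perm x s l l' : uniq l -> x \in l ->
  perm_eq (x :: l') (l ++ s) -> l' =i subst_labels x s l.
Proof.
move=> u xl e y; rewrite /subst_labels xl.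
have : perm_eq (x :: l') (x :: (rem x l ++ s)).
  apply: perm_trans e _; rewrite -cat_cons perm_cat2r; exact: perm_to_rem.
by rewrite perm_cons => /perm_mem->; rewrite rem_filter.
Qed.

Lemma sum_cat (T : Type) (F : T -> int) (s1 s2 : seq T) :
  \sum_(c <- s1 ++ s2) F c = \sum_(c <- s1) F c + \sum_(c <- s2) F c.
Proof. exact: big_cat. Qed.

Lemma map_labels1 t : flatten (map labels [:: t]) = labels t.
Proof. exact: cats0. Qed.

(** In (W) the root of [r] merges into the node of [x], and the last term cancels its
    [- w (labels r)]. In (R2) the red [r] stops being a root and gains [w (labels r)]. In (R3) the
    leaf, whose substituted weight is [- w (labels r)], disappears and the last term cancels it. *)
Lemma wsum_graft w x r t : mem_ext w -> uniq (labels t) -> x \in labels t ->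
  \sum_(u <- graft x r t) wsum w false u =
  wsum (fun l => w (subst_labels x (labels r) l)) false t + wsum w true r + w (labels r).
Proof.
move=> we; set w1 := fun l : seq nat => w _.
have w1E d : x \notin labels d -> wsum w1 false d = wsum w false d.
  move=> xd; apply: (@eq_in_wsum (predC1 x)) => [|l xl].
    by apply/allP => y yd /=; apply: contraNneq xd => <-.
  rewrite /w1 /subst_labels ifN //; by apply/negP => /(allP xl) /=; rewrite eqxx.
have w1s s : all (fun d => x \notin labels d) s ->
    \sum_(d <- s) wsum w1 false d = \sum_(d <- s) wsum w false d.
  by move=> /allP xs; apply: eq_big_seq => d /xs/w1E.
move: t; apply: graft_tree_ind => [L cs u xL|L a c b u xL xab xc IH].
  have xt : x \in labels (RWNode L cs) by rewrite labelsE mem_cat xL.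
  have := labels_graft r u xt; have := nonred_graft r u xt.
  have nr : red (RWNode L cs) = false by case: L xL {u xt}.
  rewrite wsumE nr w1s; last first.
    apply/allP => d dcs; apply/negP=> xd.
    by move: u; case/splitPr: dcs {xt nr} => a b /uniq_labels_split/(_ xd); rewrite xL => -[].
  case: r @w1 w1E w1s => Lr csr w1 _ _; set r := RWNode Lr csr; rewrite graft_in // -/r in w1 *.
  case: ifP => [rr|/negbFE rr]; last case: ifP => c.
  - rewrite big_seq1 wsumE all_seq1 => /negbTE->; rewrite map_labels1.
    move=> /(subst_labels_perm u xt)/we->.
    by rewrite /r wsumE -/r (negbTE rr) sum_cat /w1; lia.
  - rewrite big_seq1 wsumE all_seq1 => /negbTE->; rewrite map_labels1.
    move=> /(subst_labels_perm u xt)/we->.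
    by rewrite -cats1 sum_cat big_seq1 wsum_root rr /w1; lia.
  - have [e1 e2] : cs = [::] /\ L = [:: x].
      by case: cs L xL c {xt u nr} => // [] [|y [|//]] //=; rewrite inE => /eqP->.
    have w1x : w1 (labels (RWNode [:: x] [::])) = w (labels r).
      by rewrite /w1 /subst_labels /= mem_head eqxx.
    have rE : wsum w true r = \sum_(d <- csr) wsum w false d by rewrite wsumE -/r rr add0r.
    by move=> _ _; rewrite e1 e2 big_nil w1x rE; lia.
have xt : x \in labels (RWNode L (a ++ c :: b)).
  by apply: mem_labels_child xc; rewrite mem_cat mem_head orbT.
have := labels_graft r u xt; have := nonred_graft r u xt.
rewrite graft_child // big_seq1 all_seq1 map_labels1 !wsumE => /negb_inj-> /(subst_labels_perm u xt)/we->.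
move: (xab); rewrite all_cat => /andP[/w1s ea /w1s eb].
by rewrite !sum_cat -[c :: b]cat1s !sum_cat big_seq1 IH ea eb /w1 /=; case: ifP; lia.
Qed.

(** * Composition *)

(** This is [rw_comp] with both shifts stripped off, so that it applies to trees on arbitrary label
    sets; the first branch is (R1). *)
Definition plug x (r t : rwtree) :=
  if red r && is_single x t then r else head t (graft x r t).

Lemma rw_compE n x t1 t2 : rw_comp n x t1 t2 =
  plug x (relab (addn^~ x) t2) (relab (fun y => if (x < y)%N then (y + n)%N else y) t1).
Proof. by []. Qed.

Lemma is_singleP x t : reflect (t = RWNode [:: x] [::]) (is_single x t).
Proof.
apply: (iffP idP) => [|->]; last exact: eqxx.
by case: t => -[|y [|]] // [|] //= /eqP->.
Qed.

(** At the root, [graft] returns several trees only when a red [r] meets a single leaf, which is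
    (R1). Otherwise the default value of [head] is never reached. *)
Lemma graft_plug x r t : x \in labels t -> ~~ (red r && is_single x t) ->
  graft x r t = [:: plug x r t].
Proof.
rewrite /plug => xt /[dup] nrs /negbTE->.
suff /eqP : size (graft x r t) = 1%N by case: (graft x r t) => [|u []].
case: t xt nrs => L cs xt; have [xL|xL] := boolP (x \in L); last by rewrite graft_below.
case: r => Lr csr; rewrite graft_in //; case: ifP => // /negbFE rr.
case: ifP => //; rewrite rr; case: cs {xt} => //=.
by case: L xL => // y [|//]; rewrite inE => /eqP->; rewrite eqxx.
Qed.

Lemma labels_plug x r t : uniq (labels t) -> x \in labels t ->
  perm_eq (x :: labels (plug x r t)) (labels t ++ labels r).
Proof.
move=> u xt; have [|nrs] := boolP (red r && is_single x t).
  by rewrite /plug => /[dup] /andP[_ /is_singleP e] ->; rewrite e.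
by have := labels_graft r u xt; rewrite graft_plug // map_labels1.
Qed.

Lemma rw_wf_plug x r t : rw_wf r -> uniq (labels t) -> x \in labels t ->
  rw_wf t -> rw_wf (plug x r t).
Proof.
move=> wr u xt wt; have [|nrs] := boolP (red r && is_single x t).
  by rewrite /plug => ->.
by have := rw_wf_graft wr u xt wt; rewrite graft_plug // all_seq1.
Qed.

(** Outside (R1) the new root is red exactly when the old one is, so passing from [wsum_graft] to
    the root convention changes both sides by the same term. *)
Lemma wsum_plug w x r t : mem_ext w -> uniq (labels t) -> x \in labels t ->
  wsum w true (plug x r t) =
  wsum (fun l => w (subst_labels x (labels r) l)) true t + wsum w true r + w (labels r).
Proof.
move=> we u xt; have [|nrs] := boolP (red r && is_single x t).
  rewrite /plug => /[dup] /andP[_ /is_singleP e] ->; rewrite e wsumE big_nil.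
  by rewrite /subst_labels /= mem_head eqxx /=; lia.
have := wsum_graft r we u xt; rewrite graft_plug // big_seq1 !wsum_root.
have := labels_graft r u xt; have := nonred_graft r u xt.
rewrite graft_plug // all_seq1 map_labels1 => /negb_inj-> /(subst_labels_perm u xt)/we->.
by case: ifP; lia.
Qed.

(** The value [i] arises twice, from the unshifted label [i] of the first tree and from label 0 of
    the second; this is the extra [i] on the left. *)
Lemma perm_iota_comp m n i : (i < m.+1)%N ->
  perm_eq (i :: iota 0 (m + n).+1)
    (map (fun y => if (i < y)%N then (y + n)%N else y) (iota 0 m.+1)
     ++ map (addn^~ i) (iota 0 n.+1)).
Proof.
move=> im; set f := fun y => _.
have fi : f i = i by rewrite /f ltnn.
have -> : map f (iota 0 m.+1) = iota 0 i ++ i :: iota (n + i.+1) (m - i).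
  have -> : m.+1 = (i + (m - i).+1)%N by lia.
  rewrite iotaD map_cat /= add0n fi iotaDl; congr (_ ++ _ :: _).
    by apply: map_id_in => y; rewrite mem_iota => yi; rewrite /f ifN //; lia.
  apply/eq_in_map => y; rewrite mem_iota => yi; rewrite /f ifT; lia.
have -> : map (addn^~ i) (iota 0 n.+1) = iota i n.+1.
  by rewrite -[i in RHS]addn0 iotaDl; apply: eq_map => y /=; rewrite addnC.
have -> : (m + n).+1 = (i + (n.+1 + (m - i)))%N by lia.
rewrite iotaD iotaD add0n; have -> : (i + n.+1 = n + i.+1)%N by lia.
by apply/seq.permP => p; rewrite /= !count_cat /= !count_cat; lia.
Qed.

Lemma shift_inj i n : injective (fun y => if (i < y)%N then (y + n)%N else y).
Proof. by move=> x y /=; case: (ltnP i x) => ?; case: (ltnP i y) => ?; lia. Qed.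

Lemma is_rw_uniq n t : is_rw n t -> uniq (labels t).
Proof. by case/andP => /perm_uniq-> _; apply: iota_uniq. Qed.

Lemma is_rw_mem n t : is_rw n t -> forall x, (x \in labels t) = (x < n)%N.
Proof. by case/andP => /perm_mem e _ x; rewrite e mem_iota. Qed.

Lemma is_rw_all n t : is_rw n t -> all (ltn^~ n) (labels t).
Proof. by move=> tn; apply/allP => x; rewrite (is_rw_mem tn). Qed.

Lemma is_rw_wf n t : is_rw n t -> rw_wf t.
Proof. by case/andP. Qed.

Section Composition.
Variables (m n : nat) (i : 'I_m.+1) (t1 t2 : rwtree).
Hypotheses (rw1 : is_rw m.+1 t1) (rw2 : is_rw n.+1 t2).
Let f y := if (i < y)%N then (y + n)%N else y.

Let uniq_f1 : uniq (labels (relab f t1)).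
Proof. by rewrite labels_relab map_inj_uniq ?(is_rw_uniq rw1) //; apply: shift_inj. Qed.

Let mem_f1 : val i \in labels (relab f t1).
Proof.
rewrite labels_relab; apply/mapP; exists (val i); first by rewrite (is_rw_mem rw1) ltn_ord.
by rewrite /f /= ltnn.
Qed.

Lemma is_rw_comp : is_rw (m + n).+1 (rw_comp n i t1 t2).
Proof.
rewrite rw_compE; apply/andP; split; last first.
  by rewrite rw_wf_plug // !rw_wf_relab ?(is_rw_wf rw1) ?(is_rw_wf rw2).
rewrite -(perm_cons (val i)); apply: perm_trans (labels_plug _ uniq_f1 mem_f1) _.
rewrite perm_sym; apply: perm_trans (perm_iota_comp n (ltn_ord i)) _.
rewrite !labels_relab; apply: perm_cat; apply: perm_map; rewrite perm_sym.
  by case/andP: rw1.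
by case/andP: rw2.
Qed.

(** At each symbol [T] this is [wsum_plug] for the weight [set_ind T]: its three terms are the
    pushforward of the first fraction, that of the second, and the factor given by the inserted
    interval. *)
Lemma Phi_comp :
  Phi (m + n).+1 (rw_comp n i t1 t2) = ff_comp i (Phi m.+1 t1) (Phi n.+1 t2).
Proof.
apply/ffunP => T; rewrite !ffunE contrib_wsum rw_compE.
rewrite (wsum_plug _ (@set_ind_ext _ (val T))) // !wsum_relab labels_relab.
under eq_bigr do rewrite ffunE.
under [X in _ = _ + X]eq_bigr do rewrite ffunE.
have S1 := sum_contrib true _ (is_rw_wf rw1) (is_rw_all rw1).
rewrite (S1 (fun S => [set j | [exists k in S, @ins_rel m n i k j]] == val T)).
have S2 := sum_contrib true _ (is_rw_wf rw2) (is_rw_all rw2).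
rewrite (S2 (fun S => [set j : 'I_(m + n).+1 | [exists k in S, val j == (val k + i)%N]] == val T)).
(* The shifted labels of [t2] fill the interval from [i] to [i + n]. *)
have g2 (j : 'I_(m + n).+1) : (val j \in map (addn^~ i) (labels t2)) = (i <= j <= i + n)%N.
  apply/mapP/idP => [[y]|ij]; first by rewrite (is_rw_mem rw2) /= => yn ->; lia.
  by exists (j - i)%N; rewrite ?(is_rw_mem rw2) /=; lia.
rewrite -[RHS]addrA [RHS]addrC; congr (_ + _ + _).
- apply: eq_in_wsum (is_rw_all rw1) _ => l /allP lm.
  rewrite /set_ind; congr (if _ == _ then _ else _); apply/setP => j; rewrite !inE.
  have fi : f i = i by rewrite /f ltnn.
  have fil : ((i : nat) \in map f l) = ((i : nat) \in l).
    by rewrite -{1}fi mem_map //; apply: shift_inj.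
  have insE y (ym : (y < m.+1)%N) : @ins_rel m n i (Ordinal ym) j =
      if y == i then (i <= j <= i + n)%N else val j == f y.
    rewrite /ins_rel /f /=; case: ltngtP => //.
  rewrite /subst_labels fil; apply/idP/existsP => [|[[y ym]]].
    case: ifP => [il|/negbT il].
      rewrite mem_cat mem_filter g2 => /orP[/andP[/= ji /mapP[y yl e]]|ij].
        exists (Ordinal (lm y yl)); rewrite insE inE yl /=; case: eqP => [yi|_]; last exact/eqP.
        by case/eqP: ji; apply: etrans e (etrans (congr1 f yi) fi).
      exists (Ordinal (ltn_ord i)); rewrite insE inE il eqxx; exact: ij.
    case/mapP=> y yl e; exists (Ordinal (lm y yl)); rewrite insE inE yl /= ifN; first exact/eqP.
    by apply: contraNneq il => <-.
  rewrite insE inE /= => /andP[yl]; case: eqP => [yi|/eqP yi].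
    by rewrite -yi yl mem_cat yi g2 => ->; rewrite orbT.
  move/eqP=> ->; have fl : f y \in map f l by apply: map_f.
  case: ifP => // _; rewrite mem_cat mem_filter fl andbT /= -{1}fi.
  by rewrite (inj_eq (@shift_inj _ _)) yi.
- apply: eq_in_wsum (is_rw_all rw2) _ => l /allP ln.
  rewrite /set_ind; congr (if _ == _ then _ else _); apply/setP => j; rewrite !inE.
  apply/mapP/existsP => [[y yl e]|[k /andP[]]].
    by exists (Ordinal (ln y yl)); rewrite inE yl e /=.
  by rewrite inE => kl /eqP e; exists (val k).
- rewrite /set_ind eq_sym; congr (if _ == _ then _ else _); apply/setP => j; rewrite !inE; exact: g2.
Qed.
End Composition.

(** * Relabelling and injectivity *)

Definition perm_nat n (s : 'S_n) (y : nat) : nat :=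
  if (insub y : option 'I_n) is Some i then val (s i) else y.

Lemma perm_natE n (s : 'S_n) (i : 'I_n) : perm_nat s i = s i.
Proof. by rewrite /perm_nat valK. Qed.

Lemma act_rwE n (s : 'S_n) t : act_rw s t = relab (perm_nat s) t.
Proof. by []. Qed.

Lemma is_rw_act n (s : 'S_n) t : is_rw n t -> is_rw n (act_rw s t).
Proof.
case/andP=> pt wt; rewrite /is_rw act_rwE rw_wf_relab wt andbT labels_relab.
apply: perm_trans (perm_map _ pt) _; apply: uniq_perm; rewrite ?iota_uniq //.
  rewrite map_inj_in_uniq ?iota_uniq // => x y; rewrite !mem_iota => /= xn yn.
  rewrite -[x]/(val (Ordinal xn)) -[y]/(val (Ordinal yn)) !perm_natE.
  by move/val_inj/perm_inj->.
move=> x; rewrite mem_iota; apply/mapP/idP => [[y]|/= xn].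
  rewrite mem_iota => /= yn ->; rewrite -[y]/(val (Ordinal yn)) perm_natE.
  exact: ltn_ord.
exists (val ((s^-1)%g (Ordinal xn))); first by rewrite mem_iota ltn_ord.
by rewrite perm_natE permKV.
Qed.

Lemma Phi_act n (s : 'S_n) t : is_rw n t -> Phi n (act_rw s t) = act_ff s (Phi n t).
Proof.
move=> tn; apply/ffunP => T; rewrite !ffunE contrib_wsum act_rwE wsum_relab.
under eq_bigr do rewrite ffunE.
have S1 := sum_contrib true _ (is_rw_wf tn) (is_rw_all tn).
rewrite (S1 (fun S => s @: S == val T)).
apply: eq_in_wsum (is_rw_all tn) _ => l /allP ln.
rewrite /set_ind; congr (if _ == _ then _ else _); apply/setP => j; rewrite !inE.
apply/mapP/imsetP => [[y yl e]|[k]].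
  exists (Ordinal (ln y yl)); rewrite ?inE //.
  by apply/val_inj; rewrite /= -perm_natE.
by rewrite inE => kl ->; exists (val k); rewrite ?perm_natE.
Qed.

Lemma Phi_equiv n t t' : rw_equiv t t' -> Phi n t = Phi n t'.
Proof.
move=> e; apply/ffunP => T; rewrite !ffunE !contrib_wsum.
exact: rw_equiv_wsum (@set_ind_ext _ _) e.
Qed.

(** Used to reorder the children of one tree so that their keys line up with those of the other. *)
Lemma perm_map_eq (A : eqType) (B : eqType) (f : A -> B) (s s' : seq A) :
  perm_eq (map f s) (map f s') -> exists2 s'', perm_eq s' s'' & map f s'' = map f s.
Proof.
elim: s s' => [|x s IH] s'.
  by rewrite perm_sym => /perm_nilP; case: s' => // _; exists [::].
move=> e; have : f x \in map f s' by rewrite -(perm_mem e) mem_head.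
case/mapP=> y ys' fxy; case/splitPr: ys' e => a b.
rewrite /= map_cat /= fxy perm_sym -cat1s perm_catCA perm_cons perm_sym -map_cat.
case/IH=> s'' p e; exists (y :: s''); last by rewrite /= e.
by rewrite -cat1s perm_catCA perm_cons.
Qed.

(** * Recovering a tree from its family of node sets *)

Section Injectivity.
Variable n : nat.
Implicit Types (t c : rwtree) (T : {set 'I_n}).

(** Unlike [is_rw], this condition passes to subtrees, which carry only part of the labels. *)
Definition proper_labels t := [&& rw_wf t, uniq (labels t) & all (ltn^~ n) (labels t)].

Lemma proper_labels_child c L cs :
  proper_labels (RWNode L cs) -> c \in cs -> proper_labels c.
Proof.
case/and3P=> wt ut bt ccs; rewrite /proper_labels (uniq_labels_child ut ccs).
by rewrite (all_child bt ccs) !andbT; case/andP: wt => _ /allP/(_ c ccs).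
Qed.

Local Notation key := (fun t => labset n (labels t)).

Lemma key_child c L cs : c \in cs -> key c \subset key (RWNode L cs).
Proof.
by move=> ccs; apply/subsetP => x; rewrite !inE; apply: (mem_labels_child L ccs).
Qed.

Lemma key_neq0 t : proper_labels t -> key t != set0.
Proof. by case/and3P=> wt _ bt; apply: labset_neq0. Qed.

Lemma key_disjoint L a c b : proper_labels (RWNode L (a ++ c :: b)) ->
  forall d, d \in a ++ b -> [disjoint key c & key d].
Proof.
case/and3P=> _ ut _ d dab; apply/pred0P => x /=; apply/negP => /andP[].
rewrite !inE => xc xd; case: (uniq_labels_split ut xc) => _ /allP/(_ _ dab).
by rewrite xd.
Qed.

(** The root has a label outside [c]: one of its own, or else one from a second child. *)
Lemma key_child_proper c L cs : proper_labels (RWNode L cs) -> c \in cs ->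
  key c != key (RWNode L cs).
Proof.
move=> pt ccs; have /and3P[wt ut bt] := pt; case/splitPr: ccs pt wt ut bt => a b pt wt ut bt.
suff [x xt xc] : exists2 x, x \in labels (RWNode L (a ++ c :: b)) & x \notin labels c.
  have xn := allP bt x xt; apply: contraNneq xc => e.
  by have := xt; move/setP/(_ (Ordinal xn)): e; rewrite !inE /= => ->.
case: L pt wt ut {bt} => [|x L] pt wt ut.
  have [d dab] : exists d, d \in a ++ b.
    move: wt; rewrite rw_wfE size_cat /= addnS ltnS -size_cat.
    by case: (a ++ b) => // d s _; exists d; rewrite mem_head.
  have dcs : d \in a ++ c :: b by move: dab; rewrite !mem_cat inE orbCA => ->; rewrite orbT.
  have /set0Pn[x xd] := key_neq0 (proper_labels_child pt dcs).
  exists (val x); first by rewrite (mem_labels_child _ dcs) //; move: xd; rewrite inE.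
  have /pred0P/(_ x)/= := key_disjoint pt dab.
  by rewrite xd andbT !inE => ->.
exists x; first by rewrite labelsE mem_head.
by apply/negP => xc; case: (uniq_labels_split ut xc); rewrite mem_head.
Qed.

(** The set of a red root is kept although its exponent in [Phi] is 0. *)
Fixpoint node_sets t : seq {set 'I_n} :=
  let: RWNode L cs := t in key (RWNode L cs) :: flatten (map node_sets cs).

Lemma mem_node_sets T L cs :
  (T \in node_sets (RWNode L cs)) =
  (T == key (RWNode L cs)) || has (fun c => T \in node_sets c) cs.
Proof.
rewrite /= inE; congr (_ || _); apply/flattenP/hasP => [[s /mapP[c ccs ->] Tc]|[c ccs Tc]].
  by exists c.
by exists (node_sets c) => //; apply: map_f.
Qed.

Lemma key_in_node_sets t : key t \in node_sets t.
Proof. by case: t => L cs; rewrite mem_node_sets eqxx. Qed.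

Lemma node_sets_sub t T : T \in node_sets t -> T \subset key t.
Proof.
elim/rwtree_in_ind: t => L cs IH; rewrite mem_node_sets => /predU1P[-> //|/hasP[c ccs /(IH c ccs)]].
move/subset_trans; apply; exact: key_child.
Qed.

Lemma node_sets_neq0 t T : proper_labels t -> T \in node_sets t -> T != set0.
Proof.
elim/rwtree_in_ind: t => L cs IH pt; rewrite mem_node_sets => /predU1P[->|/hasP[c ccs]].
  exact: key_neq0.
by apply: IH => //; apply: proper_labels_child pt ccs.
Qed.

(** Restricting the family to subsets of [key c] isolates the child: the root set is strictly
    larger, and the nonempty sets below other children are disjoint from [key c]. This makes
    induction on the family possible. *)
Lemma node_sets_child c L cs T : proper_labels (RWNode L cs) -> c \in cs ->
  (T \in node_sets c) = (T \in node_sets (RWNode L cs)) && (T \subset key c).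
Proof.
move=> pt ccs; rewrite mem_node_sets; apply/idP/andP => [Tc|[/predU1P[->|/hasP[d dcs Td]] Tc]].
- by split; [apply/orP; right; apply/hasP; exists c|apply: node_sets_sub].
- by case/negP: (key_child_proper pt ccs); rewrite eqEsubset Tc key_child.
have T0 := node_sets_neq0 (proper_labels_child pt dcs) Td.
case/splitPr: ccs pt dcs => a b pt; rewrite mem_cat inE orbCA -mem_cat => /predU1P[<- //|dab].
have := disjointWl Tc (key_disjoint pt dab).
move/(disjointWr (node_sets_sub Td)); rewrite -setI_eq0 setIid => /eqP e.
by rewrite e eqxx in T0.
Qed.

Lemma contrib_eq0 root t T : T \notin node_sets t -> contrib root t T = 0.
Proof.
elim/rwtree_in_ind: t root => L cs IH root; rewrite mem_node_sets negb_or contribE eq_sym.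
case/andP=> /negbTE-> /hasPn Tcs; rewrite add0r big1_seq // => c /andP[_ ccs].
by apply: IH => //; apply: Tcs.
Qed.

(** A set is never attained twice: the root set exceeds every set below it, and sets from distinct
    children are disjoint. The flag [false] makes a red root visible as well. *)
Lemma contrib_neq0 t T : proper_labels t -> (contrib false t T != 0) = (T \in node_sets t).
Proof.
move=> pt; apply/idP/idP; first by apply: contraNT => /(contrib_eq0 false)->.
elim/rwtree_in_ind: t pt => L cs IH pt; rewrite mem_node_sets contribE eq_sym.
case: eqP => [e _|_ /= /hasP[c ccs Tc]].
  rewrite big1_seq ?addr0 => [|c /andP[_ ccs]]; first by case: (red _).
  apply: contrib_eq0; apply/negP => /node_sets_sub Tc.
  by case/negP: (key_child_proper pt ccs); rewrite eqEsubset {2}e Tc key_child.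
rewrite add0r; have pc := proper_labels_child pt ccs; have := IH c ccs pc Tc.
have T0 := node_sets_neq0 pc Tc.
case/splitPr: ccs pt {IH} => a b pt; have dis := key_disjoint pt.
have z d : d \in a ++ b -> contrib false d T = 0.
  move=> dab; apply: contrib_eq0; apply/negP => /node_sets_sub Td.
  have := disjointWl (node_sets_sub Tc) (dis d dab).
  by move/(disjointWr Td); rewrite -setI_eq0 setIid (negbTE T0).
have za : \sum_(d <- a) contrib false d T = 0.
  by apply: big1_seq => d /andP[_ da]; apply: z; rewrite mem_cat da.
have zb : \sum_(d <- b) contrib false d T = 0.
  by apply: big1_seq => d /andP[_ db]; apply: z; rewrite mem_cat db orbT.
by rewrite sum_cat -cat1s sum_cat big_seq1 za zb add0r addr0.
Qed.

Lemma node_sets_equiv t t' : proper_labels t -> proper_labels t' ->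
  node_sets t =i node_sets t' -> rw_equiv t t'.
Proof.
elim/rwtree_in_ind: t t' => L cs IH [L' cs'] pt pt' e.
(* The key is the largest member of the family. *)
have ek : key (RWNode L cs) = key (RWNode L' cs').
  by apply/eqP; rewrite eqEsubset !node_sets_sub ?e ?key_in_node_sets // -e key_in_node_sets.
have sub L1 cs1 L2 cs2 : proper_labels (RWNode L1 cs1) -> proper_labels (RWNode L2 cs2) ->
   node_sets (RWNode L1 cs1) =i node_sets (RWNode L2 cs2) ->
   key (RWNode L1 cs1) = key (RWNode L2 cs2) ->
   forall c, c \in cs1 -> exists2 d, d \in cs2 & key c \subset key d.
  move=> p1 p2 e12 k12 c c1; have : key c \in node_sets (RWNode L1 cs1).
    by rewrite mem_node_sets; apply/orP; right; apply/hasP; exists c => //; apply: key_in_node_sets.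
  rewrite e12 mem_node_sets -k12 (negbTE (key_child_proper p1 c1)) => /hasP[d d2 cd].
  by exists d => //; apply: node_sets_sub.
have kuniq L1 cs1 c d : proper_labels (RWNode L1 cs1) -> c \in cs1 -> d \in cs1 ->
   key c \subset key d -> c = d.
  move=> p1 c1; have k0 := key_neq0 (proper_labels_child p1 c1).
  case/splitPr: c1 p1 => a b p1; rewrite mem_cat inE orbCA -mem_cat => /predU1P[-> //|dab] cd.
  by have := disjointWr cd (key_disjoint p1 dab); rewrite -setI_eq0 setIid (negbTE k0).
(* Going from [c] to a larger [d] in the other tree and back to some [c'] forces [c = c'], so the
   inclusions are equalities. *)
have subE L1 cs1 L2 cs2 : proper_labels (RWNode L1 cs1) -> proper_labels (RWNode L2 cs2) ->
   node_sets (RWNode L1 cs1) =i node_sets (RWNode L2 cs2) ->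
   key (RWNode L1 cs1) = key (RWNode L2 cs2) ->
   forall c, c \in cs1 -> exists2 d, d \in cs2 & key c = key d.
  move=> p1 p2 e12 k12 c c1; have [d d2 cd] := sub _ _ _ _ p1 p2 e12 k12 c c1.
  have [c' c'1 dc'] := sub _ _ _ _ p2 p1 (fsym e12) (esym k12) d d2.
  have cc' := kuniq _ _ _ _ p1 c1 c'1 (subset_trans cd dc').
  by exists d => //; apply/eqP; rewrite eqEsubset cd cc'.
have ukey L1 cs1 : proper_labels (RWNode L1 cs1) -> uniq (map (fun c => key c) cs1).
  (* The induction runs over suffixes of [cs1], because [key_disjoint] needs the whole list of
     children. *)
  move=> p1; have: exists a, cs1 = a ++ cs1 by exists [::].
  elim: {2 3}cs1 => //= c s IHs [a e1]; rewrite IHs ?andbT; last first.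
    by exists (rcons a c); rewrite cat_rcons.
  apply/mapP => -[d ds kcd]; rewrite e1 in p1.
  have dab : d \in a ++ s by rewrite mem_cat ds orbT.
  have := key_disjoint p1 dab; rewrite -kcd -setI_eq0 setIid; apply/negP/key_neq0.
  by apply: proper_labels_child p1 _; rewrite mem_cat mem_head orbT.
have pk : perm_eq (map (fun c => key c) cs) (map (fun c => key c) cs').
  apply: uniq_perm; [exact: ukey pt|exact: ukey pt'|move=> K].
  apply/mapP/mapP => -[c cc ->].
    by case: (subE _ _ _ _ pt pt' e ek c cc) => d dd kd; exists d.
  by case: (subE _ _ _ _ pt' pt (fsym e) (esym ek) c cc) => d dd kd; exists d.
have [cs'' p'' e''] := perm_map_eq pk.
apply: (@RWEquiv _ _ _ _ cs'').
- have /and3P[_ ut bt] := pt; have /and3P[_ ut' bt'] := pt'.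
  (* The root's own labels are those occurring in no child, so the keys determine them. *)
  have inL L1 cs1 x : proper_labels (RWNode L1 cs1) ->
    (x \in L1) = (x \in labels (RWNode L1 cs1)) && all (fun c => x \notin labels c) cs1.
    move=> /and3P[_ u1 _]; rewrite labelsE mem_cat; have [xL1|xL1] /= := boolP (x \in L1).
      apply/esym/allP => c c1; apply/negP => xc; case/splitPr: c1 u1 => a b u1.
      by case: (uniq_labels_split u1 xc); rewrite xL1.
    apply/esym/negbTE; apply/negP => /andP[/flattenP[l /mapP[c c1 ->] xc] /allP/(_ c c1)].
    by rewrite xc.
  have keyE (l1 l2 : seq nat) x : (x < n)%N -> labset n l1 = labset n l2 -> (x \in l1) = (x \in l2).
    by move=> xn /setP/(_ (Ordinal xn)); rewrite !inE.
  have [uL uL'] : uniq L /\ uniq L'.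
    by move: ut ut'; rewrite !labelsE !cat_uniq => /andP[-> _] /andP[-> _].
  apply: uniq_perm => // x; have [xn|xn] := ltnP x n; last first.
    have big s cs0 : all (ltn^~ n) (labels (RWNode s cs0)) -> x \in s = false.
      move=> b0; apply/negP => xs; have := allP b0 x; rewrite labelsE mem_cat xs => /(_ isT) /=.
      by rewrite ltnNge xn.
    by rewrite (big _ _ bt) (big _ _ bt').
  rewrite (inL _ _ _ pt) (inL _ _ _ pt') (keyE _ _ _ xn ek); congr (_ && _).
  have half (s1 s2 : seq rwtree) : (forall c, c \in s2 -> exists2 d, d \in s1 & key c = key d) ->
     all (fun c => x \notin labels c) s1 -> all (fun c => x \notin labels c) s2.
    move=> H /allP h1; apply/allP => c /H[d /h1 xd kd]; by rewrite (keyE _ _ _ xn kd).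
  apply/idP/idP; apply: half; first exact: (subE _ _ _ _ pt' pt (fsym e) (esym ek)).
  exact: (subE _ _ _ _ pt pt' e ek).
- exact: perm_eq_Permutation.
(* Membership in the full lists is carried along while the recursion passes to tails. *)
have subcs : {subset cs <= cs} by [].
have subcs'' : {subset cs'' <= cs'} by move=> c; rewrite -(perm_mem p'').
elim: {1 2 4}cs {p''} cs'' e'' subcs subcs'' => [|c s IHs] [|d s''] //= [kdc ks] ss ss''.
have cc : c \in cs by apply: ss; rewrite mem_head.
have dd : d \in cs' by apply: ss''; rewrite mem_head.
constructor; last by apply: IHs => // x xs; [apply: ss|apply: ss'']; rewrite inE xs orbT.
apply: (IH c cc); [exact: proper_labels_child pt cc|exact: proper_labels_child pt' dd|].
by move=> T; rewrite (node_sets_child T pt cc) (node_sets_child T pt' dd) e kdc.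
Qed.

Lemma is_rw_proper t : is_rw n t -> proper_labels t.
Proof. by move=> tn; rewrite /proper_labels (is_rw_wf tn) (is_rw_uniq tn) is_rw_all. Qed.

Lemma key_is_rw t : is_rw n t -> key t = setT.
Proof. by move=> tn; apply/setP => x; rewrite !inE (is_rw_mem tn) ltn_ord. Qed.

(** The full set is the root set of both trees and the empty set belongs to neither family. For
    every other [T] the root convention does not matter, and membership is read off as a nonzero
    exponent of [Phi]. *)
Lemma Phi_inj t t' : is_rw n t -> is_rw n t' -> Phi n t = Phi n t' -> rw_equiv t t'.
Proof.
move=> tn tn' eP; have pt := is_rw_proper tn; have pt' := is_rw_proper tn'.
apply: node_sets_equiv => // T.
have [->|TT] := eqVneq T setT; first by rewrite -{1}(key_is_rw tn) -(key_is_rw tn') !key_in_node_sets.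
have [->|T0] := eqVneq T set0.
  by apply/idP/idP => /node_sets_neq0; rewrite ?eqxx => /(_ _)/negP[].
have root u : is_rw n u -> contrib false u T = contrib true u T.
  move=> un; rewrite !contrib_wsum wsum_root -!contrib_wsum /set_ind (key_is_rw un).
  by rewrite eq_sym (negbTE TT) if_same addr0.
rewrite -!contrib_neq0 // !root //; congr (_ != _).
by move/ffunP/(_ (exist (fun S : {set 'I_n} => is_true (S != set0)) _ T0)): eP; rewrite !ffunE.
Qed.

End Injectivity.

(** * Generation *)

Local Notation leaf x := (RWNode [:: x] [::]).

Lemma Phi_unit : Phi 1 rw_unit = ff_unit.
Proof.
apply/ffunP => T; rewrite !ffunE /= eq_sym big_nil addr0.
have -> : labset 1 [:: 0%N] = [set ord0] by apply/setP => x; rewrite !inE ord1.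
by rewrite eq_sym; case: eqP.
Qed.

Lemma labset2 : labset 2 [:: 0; 1]%N = setT.
Proof. by apply/setP => -[[|[|//]] ?]; rewrite !inE. Qed.

Lemma labset2' : labset 2 [:: 1; 0]%N = setT.
Proof. by apply/setP => -[[|[|//]] ?]; rewrite !inE. Qed.

Lemma labset20 : labset 2 [:: 0]%N = [set ord0].
Proof. by apply/setP => -[[|[|//]] ?]; rewrite !inE. Qed.

Lemma labset21 : labset 2 [:: 1]%N = [set ord_max].
Proof. by apply/setP => -[[|[|//]] ?]; rewrite !inE. Qed.

Lemma Phi_succ : Phi 2 (RWNode [:: 1%N] [:: leaf 0%N]) = F_succ.
Proof.
apply/ffunP => T; rewrite !ffunE ![val T == _]eq_sym contrib_wsum wsumE big_seq1 wsumE big_nil /=.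
by rewrite /set_ind labset2' labset20; do ?[case: (_ == _)].
Qed.

Lemma Phi_mu : Phi 2 (RWNode [:: 0; 1]%N [::]) = F_mu.
Proof.
apply/ffunP => T; rewrite !ffunE ![val T == _]eq_sym contrib_wsum wsumE big_nil /=.
by rewrite /set_ind labset2; do ?[case: (_ == _)].
Qed.

Lemma Phi_odot : Phi 2 (RWNode [::] [:: leaf 0%N; leaf 1%N]) = F_odot.
Proof.
apply/ffunP => T; rewrite !ffunE ![val T == _]eq_sym contrib_wsum wsumE big_cons big_seq1.
by rewrite !wsumE !big_nil /= /set_ind labset20 labset21; do ?[case: (_ == _)].
Qed.

Lemma gen_is_Phi n (F : FF n) : gen F -> exists2 t, is_rw n t & Phi n t = F.
Proof.
elim=> {n F} [|||| m n i _ _ _ [t tm <-] _ [u un <-] | n s _ _ [t tn <-]].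
- by exists rw_unit => //; exact: Phi_unit.
- by exists (RWNode [:: 1%N] [:: leaf 0%N]) => //; exact: Phi_succ.
- by exists (RWNode [:: 0; 1]%N [::]) => //; exact: Phi_mu.
- by exists (RWNode [::] [:: leaf 0%N; leaf 1%N]) => //; exact: Phi_odot.
- by exists (rw_comp n i t u); [exact: is_rw_comp|exact: Phi_comp].
- by exists (act_rw s t); [exact: is_rw_act|exact: Phi_act].
Qed.

Lemma rw_equiv_refl t : rw_equiv t t.
Proof.
elim/rwtree_in_ind: t => L cs IH; apply: (@RWEquiv _ _ _ _ cs) => //.
elim: cs IH => // c cs IHcs IH; constructor; first by apply: IH; rewrite mem_head.
by apply: IHcs => d dcs; apply: IH; rewrite inE dcs orbT.
Qed.

Lemma map_index_id (l : seq nat) : uniq l -> map (index^~ l) l = iota 0 (size l).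
Proof.
move=> ul; apply: (@eq_from_nth _ 0%N); rewrite ?size_map ?size_iota // => i il.
by rewrite (nth_map 0%N) // nth_iota // index_uniq.
Qed.

Lemma is_rw_index l t : rw_wf t -> uniq (labels t) -> perm_eq l (labels t) ->
  is_rw (size l) (relab (index^~ l) t).
Proof.
move=> wt ut p; rewrite /is_rw rw_wf_relab wt andbT labels_relab.
rewrite -map_index_id ?(perm_uniq p) //.
by apply: perm_map; rewrite perm_sym.
Qed.

(* Label-independent membership in the generated operad: the labels of [t] are
   renamed to [0..n-1] along an arbitrary enumeration [l]. *)
Definition tree_generated t := [/\ rw_wf t, uniq (labels t) &
  forall l, perm_eq l (labels t) -> gen (Phi (size l) (relab (index^~ l) t))].

(** One enumeration suffices, since any other differs from it by a permutation, under which [gen] is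
    closed. *)
Lemma generatedI l0 t : rw_wf t -> uniq (labels t) -> perm_eq l0 (labels t) ->
  gen (Phi (size l0) (relab (index^~ l0) t)) -> tree_generated t.
Proof.
move=> wt ut p0 g0; split=> // l pl; have u0 : uniq l0 by rewrite (perm_uniq p0).
have pl0 : perm_eq l l0 by apply: perm_trans pl _; rewrite perm_sym.
have ul : uniq l by rewrite (perm_uniq pl0).
rewrite (perm_size pl0); set n := size l0 in g0 *.
(* The permutation sends a position in [l0] to the position of the same label in [l]. *)
have sP (i : 'I_n) : (index (nth 0%N l0 i) l < n)%N.
  suff : (index (nth 0%N l0 i) l < size l)%N by rewrite (perm_size pl0).
  by rewrite index_mem (perm_mem pl0) mem_nth.
have s_inj : injective (fun i => Ordinal (sP i)).
  move=> i j /(congr1 val) /= e; apply/val_inj/eqP.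
  rewrite -(nth_uniq 0%N _ _ u0) ?ltn_ord //; apply/eqP.
  by apply: (index_inj 0%N _ _ e); rewrite (perm_mem pl0) mem_nth.
have -> : relab (index^~ l) t = act_rw (perm s_inj) (relab (index^~ l0) t).
  rewrite act_rwE relab_comp; apply: eq_in_relab => x xt /=.
  have x0 : (index x l0 < n)%N by rewrite index_mem (perm_mem p0).
  by rewrite -[index x l0]/(val (Ordinal x0)) perm_natE permE /= nth_index ?(perm_mem p0).
rewrite Phi_act; first exact: gen_act.
exact: is_rw_index.
Qed.

Lemma generated_gen n t : tree_generated t -> is_rw n t -> gen (Phi n t).
Proof.
case=> wt ut g tn; have := g (iota 0 n); rewrite size_iota relab_id.
  by apply; rewrite perm_sym; case/andP: tn.
move=> x; rewrite (is_rw_mem tn) => xn /=.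
have e : nth 0%N (iota 0 n) x = x := nth_iota 0 0 xn.
by rewrite -{1}e index_uniq ?size_iota ?iota_uniq.
Qed.

Lemma generated_perm L cs cs' : perm_eq cs cs' ->
  tree_generated (RWNode L cs) -> tree_generated (RWNode L cs').
Proof.
move=> p [wt ut g].
have pl : perm_eq (labels (RWNode L cs)) (labels (RWNode L cs')).
  by rewrite !labelsE perm_cat2l; apply/perm_flatten/perm_map.
split.
- by move: wt; rewrite !rw_wfE (perm_size p) (perm_all _ p).
- by rewrite -(perm_uniq pl).
move=> l pl'; have := g l; rewrite (perm_trans pl') 1?perm_sym // => /(_ isT).
rewrite (@Phi_equiv _ _ (relab (index^~ l) (RWNode L cs'))) //.
apply: (@RWEquiv _ _ _ _ (map (relab (index^~ l)) cs)) => //.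
  by apply/perm_eq_Permutation/perm_map; rewrite perm_sym.
elim: (map _ cs) => //= c s IHs; constructor => //; exact: rw_equiv_refl.
Qed.

(** * Closure of generated trees under composition *)

Lemma map_rem_in (g : nat -> nat) x (L : seq nat) : uniq L -> x \in L ->
  {in L &, injective g} -> rem (g x) (map g L) = map g (rem x L).
Proof.
move=> uL xL gi; rewrite !rem_filter ?map_inj_in_uniq // filter_map.
congr map; apply: eq_in_filter => y yL /=.
by rewrite (inj_in_eq gi).
Qed.

(** Three relabellings occur because [x] is renamed in [t] but is absent from the result: [f] needs
    to agree with [g] only away from [x], and with [h] on [r]. *)
Lemma relab_graft f g h x r t : uniq (labels t) -> x \in labels t ->
  {in labels t &, injective g} -> {in labels t, forall y, y != x -> f y = g y} ->
  {in labels r, f =1 h} ->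
  map (relab f) (graft x r t) = graft (g x) (relab h r) (relab g t).
Proof.
move=> ut xt gi fg fh; move: t ut xt gi fg.
apply: graft_tree_ind => [L cs u xL gi fg|L a c b u xL xab xc IH gi fg].
  case: r fh => Lr csr fh; rewrite [relab h _]/= [relab g _]/= !graft_in ?map_f //.
  have uL : uniq L by move: u; rewrite labelsE cat_uniq => /andP[].
  have sL : {subset L <= labels (RWNode L cs)} by move=> y yL; rewrite labelsE mem_cat yL.
  rewrite map_rem_in //; last by move=> y z yL zL; apply: gi; apply: sL.
  have -> : map g (rem x L) = map f (rem x L).
    apply/eq_in_map => y; rewrite mem_rem_uniq // inE => /andP[yx yL].
    by rewrite fg // sL.
  have -> : map (relab g) cs = map (relab f) cs.
    apply/eq_in_map => d dcs; apply: eq_in_relab => y yd.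
    rewrite fg //; first exact: mem_labels_child dcs _ yd.
    apply: contraTneq xL => <-; case/splitPr: dcs u {fg gi sL} => a b u.
    by case: (uniq_labels_split u yd).
  rewrite -[RWNode (map h Lr) _]/(relab h (RWNode Lr csr)) red_relab.
  rewrite -(eq_in_relab fh).
  have -> : map h Lr = map f Lr.
    by apply/eq_in_map => y yL; rewrite fh // labelsE mem_cat yL.
  have -> : map (relab h) csr = map (relab f) csr.
    apply/eq_in_map => d dcs; apply: eq_in_relab => y yd.
    by rewrite fh //; apply: mem_labels_child dcs _ yd.
  rewrite size_map; have -> : nilp (map (relab f) cs) = nilp cs by case: cs {u gi fg sL}.
  case: ifP => _; first by rewrite /= !map_cat.
  by case: ifP => // _; rewrite /= map_rcons.
have xt : x \in labels (RWNode L (a ++ c :: b)).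
  by apply: mem_labels_child xc; rewrite mem_cat mem_head orbT.
have sub d : d \in a ++ c :: b -> {subset labels d <= labels (RWNode L (a ++ c :: b))}.
  by move=> dcs; apply: mem_labels_child.
have gx y : y \in labels (RWNode L (a ++ c :: b)) -> y != x -> g y != g x.
  by move=> yt; apply: contraNneq => /gi->.
have sL : {subset L <= labels (RWNode L (a ++ c :: b))} by move=> y yL; rewrite labelsE mem_cat yL.
have eab s : {subset s <= a ++ b} -> map (relab f) s = map (relab g) s.
  move=> ss; apply/eq_in_map => d /ss dab; apply: eq_in_relab => y yd; rewrite fg //.
    apply: sub yd; move: dab; rewrite !mem_cat inE orbCA => ->; exact: orbT.
  by apply: contraTneq yd => ->; apply: (allP xab).
rewrite graft_child // [relab g _]/= map_cat map_cons graft_child.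
- rewrite /= !map_cat IH.
  + rewrite !eab => [|d db|d da]; rewrite ?mem_cat ?da ?db ?orbT //.
    congr [:: RWNode _ _]; apply/eq_in_map => y yL; rewrite fg ?sL //.
    by apply: contraNneq xL => <-.
  + by move=> y z yc zc; apply: gi; apply: (sub c) => //; rewrite mem_cat mem_head orbT.
  + by move=> y yc; apply: fg; apply: (sub c) => //; rewrite mem_cat mem_head orbT.
- apply/mapP => -[y yL] /esym/eqP; apply/negP/gx; rewrite ?sL //.
  by apply: contraNneq xL => <-.
rewrite -map_cat all_map; apply/allP => d dab /=; rewrite labels_relab.
have xd := allP xab d dab.
apply/mapP => -[y yd] /esym/eqP; apply/negP/gx; last by apply: contraNneq xd => <-.
apply: sub yd; move: dab; rewrite !mem_cat inE orbCA => ->; exact: orbT.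
Qed.

Lemma relab_plug f g h x r t : uniq (labels t) -> x \in labels t ->
  {in labels t &, injective g} -> {in labels t, forall y, y != x -> f y = g y} ->
  {in labels r, f =1 h} ->
  relab f (plug x r t) = plug (g x) (relab h r) (relab g t).
Proof.
move=> ut xt gi fg fh.
have e : is_single (g x) (relab g t) = is_single x t.
  by case: t xt {ut gi fg} => [[|y [|z L]] [|c cs]] //=; rewrite inE => /eqP->; rewrite !eqxx.
have [rs|nrs] := boolP (red r && is_single x t).
  by rewrite /plug red_relab e rs; apply: eq_in_relab.
have := relab_graft ut xt gi fg fh; rewrite !graft_plug ?red_relab ?e //.
  by case.
by rewrite labels_relab map_f.
Qed.

(** Composition in the operad carried over to arbitrary disjoint label sets, so that later
    constructions can ignore the numbering. *)
Lemma generated_plug x r t : tree_generated t -> tree_generated r -> x \in labels t ->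
  {in labels r, forall y, y \notin labels t} -> tree_generated (plug x r t).
Proof.
case=> wt ut gt [wr ur gr] xt dis.
(* With [x] enumerated first, the composition takes place at position 0, and its shift numbers the
   labels of [r] first and those of [s] after them. *)
pose s := rem x (labels t).
have pt : perm_eq (x :: s) (labels t) by rewrite perm_sym perm_to_rem.
have pp := labels_plug r ut xt.
have pl : perm_eq (labels r ++ s) (labels (plug x r t)).
  rewrite perm_sym -(perm_cons x); apply: perm_trans pp _.
  by rewrite perm_catC -[x :: _ ++ _]cat1s perm_sym perm_catCA perm_cat2l.
have up : uniq (labels (plug x r t)).
  have: uniq (x :: labels (plug x r t)).
    rewrite (perm_uniq pp) cat_uniq ut ur andbT; apply/hasPn => y yr; exact: dis.
  by case/andP.
apply: generatedI pl _ => //; first exact: rw_wf_plug.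
have [n nE] : exists n, size (labels r) = n.+1.
  by have := wf_labels_neq0 wr; case: (labels r) => // y l _; exists (size l).
have gm := gt _ pt; have gn := gr _ (perm_refl _).
rewrite nE in gn; rewrite /= in gm.
have rt := is_rw_index wt ut pt; have rr := is_rw_index wr ur (perm_refl _).
rewrite nE in rr; rewrite /= in rt.
have := gen_comp (ord0 : 'I_(size s).+1) gm gn.
rewrite -Phi_comp // size_cat nE addSn addnC rw_compE.
rewrite !relab_comp; congr (gen (Phi _ _)); symmetry.
have xs : x \notin s by rewrite mem_rem_uniqF.
have us : uniq s by apply: rem_uniq.
have memt y : y \in labels t -> y != x -> y \in s by move=> yt yx; rewrite mem_rem_uniq // inE yx.
set g := (X in plug _ _ (relab X _)).
have gx : g x = 0%N by rewrite /g /= eqxx.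
have gE y : y \in labels t -> y != x -> g y = (size (labels r) + index y s)%N.
  by move=> yt yx; rewrite /g /= eq_sym (negbTE yx) nE ltn0Sn; lia.
rewrite -[ord0 : nat]gx; apply: relab_plug => //.
- move=> y z yt zt.
  have [->|yx] := eqVneq y x; have [->|zx] := eqVneq z x => //.
  + by rewrite gx gE // nE.
  + by rewrite gx gE // nE.
  rewrite !gE // => /addnI; apply: (index_inj 0%N); exact: memt.
- move=> y yt yx; rewrite gE // index_cat ifN //.
  by apply: contraTN yt; apply: dis.
- by move=> y yr; rewrite /= gx addn0 index_cat yr.
Qed.

(** * Building trees from the three generators *)

Lemma plug_in x Lr csr L cs (r := RWNode Lr csr) : x \in L -> ~~ red r ->
  plug x r (RWNode L cs) = RWNode (rem x L ++ Lr) (cs ++ csr).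
Proof. by move=> xL nr; rewrite /plug (negbTE nr) graft_in // nr. Qed.

Lemma plug_in_red x r L cs : x \in L -> red r -> ~~ nilp cs || (1 < size L)%N ->
  plug x r (RWNode L cs) = RWNode (rem x L) (rcons cs r).
Proof.
move=> xL rr big; rewrite /plug; case: is_singleP => [[eL ecs]|_].
  by rewrite eL ecs in big.
by case: r rr => Lr csr rr; rewrite andbF graft_in // rr big.
Qed.

Lemma plug_child x r L a c b : x \notin L ->
  all (fun d => x \notin labels d) (a ++ b) ->
  plug x r (RWNode L (a ++ c :: b)) = RWNode L (a ++ graft x r c ++ b).
Proof.
move=> xL xab; rewrite /plug; case: is_singleP => [[_ e]|_]; last by rewrite andbF graft_child.
by case: a {xab} e.
Qed.

Lemma graft_leaf_nonred x r : ~~ red r -> graft x r (leaf x) = [:: r].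
Proof. by case: r => L cs nr; rewrite graft_in ?mem_head // nr /= eqxx. Qed.

Lemma graft_leaf_red x r : red r -> graft x r (leaf x) = rw_children r.
Proof. by case: r => L cs rr; rewrite graft_in ?mem_head // rr. Qed.

Lemma fresh_label (s : seq nat) : exists a, a \notin s.
Proof.
exists (sumn s).+1; apply/negP => /perm_to_rem/perm_sumn /=; lia.
Qed.

Lemma generated_leaf x : tree_generated (leaf x).
Proof.
apply: (@generatedI [:: x]) => //=; rewrite eqxx -/rw_unit Phi_unit; exact: gen_unit.
Qed.

Section TwoLabels.
Variables (a b : nat).
Hypothesis ab : a != b.

Lemma generated_mu : tree_generated (RWNode [:: a; b] [::]).
Proof.
apply: (@generatedI [:: a; b]) => //=; first by rewrite inE ab.
by rewrite !eqxx (negbTE ab) Phi_mu; exact: gen_mu.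
Qed.

Lemma generated_succ : tree_generated (RWNode [:: b] [:: leaf a]).
Proof.
apply: (@generatedI [:: a; b]) => //.
- by rewrite /= inE eq_sym ab.
- by rewrite -[[:: a; b]]/([:: a] ++ [:: b]) perm_catC.
by rewrite /= !eqxx (negbTE ab) Phi_succ; exact: gen_succ.
Qed.

Lemma generated_odot : tree_generated (RWNode [::] [:: leaf a; leaf b]).
Proof.
apply: (@generatedI [:: a; b]) => //=; first by rewrite inE ab.
by rewrite !eqxx (negbTE ab) Phi_odot; exact: gen_odot.
Qed.
End TwoLabels.

(** By (W), grafting the tree into [b] of the single node with labels [a], [b] leaves [a] beside the
    root labels. *)
Lemma generated_add_label a L cs : ~~ red (RWNode L cs) -> a \notin labels (RWNode L cs) ->
  tree_generated (RWNode L cs) -> tree_generated (RWNode (a :: L) cs).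
Proof.
move=> nr ta gt; have [b] := fresh_label (a :: labels (RWNode L cs)).
rewrite inE negb_or => /andP[ba bt]; have ab : a != b by rewrite eq_sym.
have := @generated_plug b _ _ (generated_mu ab) gt.
rewrite plug_in ?inE ?eqxx ?orbT // [rem _ _]/= (negbTE ab) /= eqxx => H; apply: H => //.
by move=> y yt; rewrite !inE negb_or; apply/andP; split; apply: contraTneq yt => ->.
Qed.

(** First the tree of [F_succ] adds a leaf [a] below the root; then (W) turns this leaf into [c]. *)
Lemma generated_add_nonred L cs c : ~~ red (RWNode L cs) -> ~~ red c ->
  {in labels c, forall y, y \notin labels (RWNode L cs)} ->
  tree_generated (RWNode L cs) -> tree_generated c -> tree_generated (RWNode L (c :: cs)).
Proof.
move=> nr nc dis gt gc.
have [a] := fresh_label (labels c ++ labels (RWNode L cs)).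
rewrite mem_cat negb_or => /andP[ac at_].
have [b] := fresh_label (a :: labels (RWNode L cs)).
rewrite inE negb_or => /andP[ba bt]; have ab : a != b by rewrite eq_sym.
have g1 : tree_generated (RWNode L (leaf a :: cs)).
  have := @generated_plug b _ _ (generated_succ ab) gt.
  rewrite plug_in ?inE ?eqxx // [rem _ _]/= eqxx /= => H; apply: H => //.
  by move=> y yt; rewrite !inE negb_or; apply/andP; split; apply: contraTneq yt => ->.
have := @generated_plug a _ _ g1 gc.
have [aL acs] : a \notin L /\ all (fun d => a \notin labels d) cs.
  split; first by move: at_; rewrite labelsE mem_cat negb_or => /andP[].
  by apply/allP => d dcs; apply: notin_child at_ dcs.
rewrite (@plug_child _ _ _ [::]) // graft_leaf_nonred //; apply.
  by rewrite labelsE mem_cat /= mem_head orbT.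
move=> y yc; have := dis y yc; rewrite !labelsE /= !mem_cat inE !negb_or => /andP[-> ->].
by rewrite andbT; apply: contraNneq ac => <-.
Qed.

(** Grafting a red [c] into a leaf would dissolve its root by (R3). Instead an auxiliary label [a]
    is added to the root, and (R2) at [a] hangs [c] below it. *)
Lemma generated_add_red L cs c : ~~ red (RWNode L cs) -> red c ->
  {in labels c, forall y, y \notin labels (RWNode L cs)} ->
  tree_generated (RWNode L cs) -> tree_generated c -> tree_generated (RWNode L (c :: cs)).
Proof.
move=> nr rc dis gt gc.
have [a] := fresh_label (labels c ++ labels (RWNode L cs)).
rewrite mem_cat negb_or => /andP[ac at_].
have := @generated_plug a _ _ (generated_add_label nr at_ gt) gc.
rewrite plug_in_red ?mem_head //; last by case: L cs nr {dis gt at_} => [|? ?] [].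
rewrite /= eqxx => H; apply: generated_perm (H _ _); rewrite ?mem_head //.
  by rewrite perm_rcons.
move=> y yc; rewrite inE negb_or; have := dis y yc; rewrite labelsE => ->.
by rewrite andbT; apply: contraNneq ac => <-.
Qed.

Lemma generated_add L cs c : ~~ red (RWNode L cs) ->
  {in labels c, forall y, y \notin labels (RWNode L cs)} ->
  tree_generated (RWNode L cs) -> tree_generated c -> tree_generated (RWNode L (c :: cs)).
Proof.
by case: (boolP (red c)) => ? ? ?; [apply: generated_add_red|apply: generated_add_nonred].
Qed.

(** In the tree of [F_odot], grafting [t] into leaf [b] gives either the child [t] or, by (R3), the
    children of a red [t]; then [c] replaces leaf [a] by (W). *)
Lemma generated_red_pair c t : ~~ red c ->
  {in labels c, forall y, y \notin labels t} -> tree_generated t -> tree_generated c ->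
  tree_generated (RWNode [::] (c :: if red t then rw_children t else [:: t])).
Proof.
move=> nc dis gt gc.
have [a] := fresh_label (labels c ++ labels t).
rewrite mem_cat negb_or => /andP[ac at_].
have [b] := fresh_label (a :: labels t).
rewrite inE negb_or => /andP[ba bt]; have ab : a != b by rewrite eq_sym.
set s := if red t then _ else _.
have sE : flatten (map labels s) = labels t.
  rewrite /s; case: ifP => [|_]; last exact: map_labels1.
  by case: (t) => L cs; rewrite redE => /andP[/eqP-> _].
have g1 : tree_generated (RWNode [::] (leaf a :: s)).
  have := @generated_plug b _ _ (generated_odot ab) gt.
  rewrite (@plug_child _ _ _ [:: leaf a]) //; last by rewrite /= inE ba.
  rewrite cats0; have -> : graft b t (leaf b) = s.
    by rewrite /s; case: ifP => [/graft_leaf_red//|/negbT/graft_leaf_nonred].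
  apply; first by rewrite !inE eqxx orbT.
  by move=> y yt; rewrite !inE negb_or; apply/andP; split; apply: contraTneq yt => ->.
have := @generated_plug a _ _ g1 gc.
rewrite (@plug_child _ _ _ [::]) //; last first.
  apply/allP => d ds; apply: contra at_ => ad; rewrite -sE.
  by apply/flattenP; exists (labels d) => //; apply: map_f.
rewrite graft_leaf_nonred //; apply; first by rewrite labelsE mem_head.
move=> y yc; rewrite labelsE /= sE inE negb_or dis // andbT.
by apply: contraNneq ac => <-.
Qed.

(** Starting from a root labelled [a] with child [d], (R2) at [a] attaches [c] and empties the
    root. *)
Lemma generated_pair_red c d : red c ->
  {in labels c, forall y, y \notin labels d} -> tree_generated d -> tree_generated c ->
  tree_generated (RWNode [::] [:: d; c]).
Proof.
move=> rc dis gd gc; have [a] := fresh_label (labels c ++ labels d).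
rewrite mem_cat negb_or => /andP[ac ad].
have g1 : tree_generated (RWNode [:: a] [:: d]).
  apply: generated_add => //; last exact: generated_leaf.
  by move=> y yd; rewrite inE; apply: contraNneq ad => <-.
have := @generated_plug a _ _ g1 gc.
rewrite plug_in_red ?mem_head // /= eqxx => H; apply: H => //.
move=> y yc; rewrite /= cats0 inE negb_or dis // andbT.
by apply: contraNneq ac => <-.
Qed.

(** Counts nodes and labels together, so that it drops when either a child or a root label is taken
    away. *)
Fixpoint weight (t : rwtree) : nat :=
  let: RWNode L cs := t in (size L + sumn (map weight cs)).+1.

Lemma weightE L cs : weight (RWNode L cs) = (size L + sumn (map weight cs)).+1.
Proof. by []. Qed.

Lemma weight_gt0 t : (0 < weight t)%N.
Proof. by case: t. Qed.

Lemma labels_cons L c cs :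
  perm_eq (labels (RWNode L (c :: cs))) (labels c ++ labels (RWNode L cs)).
Proof. by rewrite !labelsE /= perm_catCA. Qed.

Lemma uniq_labels_cons L c cs : uniq (labels (RWNode L (c :: cs))) ->
  [/\ uniq (labels c), uniq (labels (RWNode L cs)) &
      {in labels c, forall y, y \notin labels (RWNode L cs)}].
Proof.
rewrite (perm_uniq (labels_cons L c cs)) cat_uniq => /and3P[-> /hasPn dis ->]; split=> //.
by move=> y yc; apply/negP => /dis/negP.
Qed.

Lemma proper_generated t : rw_wf t -> uniq (labels t) -> tree_generated t.
Proof.
have [k] := ubnP (weight t); elim: k t => // k IH [L cs].
rewrite weightE ltnS => wk wt ut.
case: L wk wt ut => [|a L] wk wt ut; last first.
  (* With a labelled root, children are removed first, then all labels but one. *)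
  case: cs wk wt ut => [|c cs] wk wt ut.
    case: L wk wt ut => [|b L] wk wt ut; first exact: generated_leaf.
    move: ut; rewrite labelsE cats0 cons_uniq => /andP[aL uL].
    apply: generated_add_label; rewrite ?labelsE ?cats0 //.
    by apply: IH; rewrite ?labelsE ?cats0.
  have [uc u' dis] := uniq_labels_cons ut.
  move: wt; rewrite rw_wfE /= => /andP[wc wcs].
  rewrite /= in wk.
  apply: generated_add => //; apply: IH => //; have := weight_gt0 c; rewrite ?weightE /=; lia.
(* An empty root without red children is red: one child [c] is split off, and the others form a
   single non-red tree or a smaller red tree whose root merges. *)
have [/allP nred|] := boolP (all (fun c => ~~ red c) cs).
  case: cs wk wt ut nred => [//|c [//|d cs]] wk wt ut nred.
  have [uc u' dis] := uniq_labels_cons ut.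
  have nc : ~~ red c by apply: nred; rewrite mem_head.
  move: wt; rewrite rw_wfE /= => /and3P[wc wd wcs]; rewrite /= in wk.
  have gc : tree_generated c by apply: IH => //; lia.
  case: cs wk ut nred u' dis wcs => [|e cs] wk ut nred u' dis wcs.
    have := @generated_red_pair c d nc; rewrite ifN; last by apply: nred; rewrite !inE eqxx orbT.
    rewrite labelsE map_labels1 in u' dis.
    by apply => //; apply: IH => //; lia.
  have rt : red (RWNode [::] [:: d, e & cs]).
    by rewrite redE eqxx; apply/allP => x xs; apply: nred; rewrite inE xs orbT.
  have := @generated_red_pair c _ nc dis; rewrite rt; apply=> //.
  apply: IH => //; first by have := weight_gt0 c; rewrite weightE /=; move: wk => /=; lia.
  by rewrite rw_wfE /= wd.
rewrite -has_predC => /hasP[c ccs /= /negbNE rc].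
(* Some child [c] is red. Another child [d] is moved to the front and split off, so that [c] remains
   and keeps the root non-red when three or more children are present. *)
have [d [rest p]] : exists d rest, perm_eq [:: d, c & rest] cs.
  case/splitPr: ccs wt {wk ut} => a b; rewrite rw_wfE size_cat /= addnS ltnS -size_cat => /andP[s2 _].
  case: a s2 => [|d a] s2; last first.
    by exists d, (a ++ b); rewrite /= perm_cons -cat1s perm_catCA.
  case: b s2 => [//|d b] _; exists d, b.
  by rewrite -[[:: d, c & b]]/([:: d] ++ [:: c] ++ b) perm_catCA.
apply: (generated_perm p).
have {}wk : (sumn (map weight [:: d, c & rest]) < k)%N.
  by rewrite (perm_sumn (perm_map weight p)).
have {}wt : rw_wf (RWNode [::] [:: d, c & rest]).
  by move: wt; rewrite !rw_wfE (perm_size p) (perm_all _ p).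
have {}ut : uniq (labels (RWNode [::] [:: d, c & rest])).
  by rewrite (perm_uniq (perm_flatten (perm_map labels p))).
have [ud u' dis] := uniq_labels_cons ut; have [uc _ _] := uniq_labels_cons u'.
move: wt; rewrite rw_wfE /= => /and3P[wd wc wr]; rewrite /= in wk.
have gd : tree_generated d by apply: IH => //; lia.
have gc : tree_generated c by apply: IH => //; lia.
case: rest wk wr u' dis {p ut} => [|e rest] wk wr u' dis.
  apply: generated_pair_red => // y yc; apply/negP => /dis.
  by rewrite labelsE /= cats0 yc.
apply: generated_add => //; first by rewrite redE /= rc.
apply: IH => //; first by have := weight_gt0 d; rewrite weightE /=; move: wk => /=; lia.
by rewrite rw_wfE /= wc.
Qed.

Theorem mainTheorem16 :
  (* Phi is well defined on RW(n) (unordered trees) *)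
  (forall n t t', is_rw n t -> rw_equiv t t' -> Phi n t = Phi n t') /\
  (* Phi preserves the unit *)
  Phi 1 rw_unit = ff_unit /\
  (* Phi is equivariant *)
  (forall n (s : 'S_n) t, is_rw n t -> Phi n (act_rw s t) = act_ff s (Phi n t)) /\
  (* Phi preserves partial compositions *)
  (forall m n (i : 'I_m.+1) t1 t2, is_rw m.+1 t1 -> is_rw n.+1 t2 ->
     Phi (m + n).+1 (rw_comp n i t1 t2) = ff_comp i (Phi m.+1 t1) (Phi n.+1 t2)) /\
  (* Phi is injective on each RW(n) *)
  (forall n t t', is_rw n t -> is_rw n t' -> Phi n t = Phi n t' -> rw_equiv t t') /\
  (* the image of Phi is the sub-operad generated by F_succ, F_mu, F_odot *)
  (forall n (F : FF n), gen F <-> exists2 t, is_rw n t & Phi n t = F).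
Proof.
split; first by move=> n t t' _; exact: Phi_equiv.
split; first exact: Phi_unit.
split; first exact: Phi_act.
split; first by move=> m n i t1 t2; exact: Phi_comp.
split; first exact: Phi_inj.
move=> n F; split; first exact: gen_is_Phi.
case=> t tn <-; apply: generated_gen => //.
by apply: proper_generated; [exact: is_rw_wf tn|exact: is_rw_uniq tn].
Qed.
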